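(* Let $p\ge1$ be an integer, $G$ a nonvanishing log-harmonic mapping in $\mathbb{D}$, $\lambda_1,\dots,\lambda_p\in\mathbb{C}$, and $F(z)=\prod_{k=1}^{p}G(z)^{\lambda_k|z|^{2(k-1)}}$ for $z\in\mathbb{D}$. Suppose that $\log F$ and $\log G$ are both univalent in $\mathbb{D}$ and that $\sum_{k=1}^{p}\lambda_k|z|^{2(k-1)}\neq0$ for $z\in\mathbb{D}\setminus\{0\}$. Then $\log G$ is starlike if and only if $\log F$ is starlike.
   Context: $\mathbb{D}=\{z\in\mathbb{C}:|z|<1\}$. A nonvanishing log-harmonic mapping $G$ in $\mathbb{D}$ is a nonvanishing solution of $\overline{G_{\overline z}}/\overline{G}=a\,G_z/G$ for some analytic function $a$; such $G$ is of the form $G=g_1\overline{g_2}$ with $g_1,g_2$ nonvanishing analytic functions in $\mathbb{D}$ (take this form as part of the definition). Thus $\log G=\log g_1+\overline{\log g_2}$, for fixed analytic branches of the logarithms, is a harmonic function in $\mathbb{D}$. Powers are defined by $G^{w}=\exp(w\log G)$ and, correspondingly, $\log F(z)=\Big(\sum_{k=1}^{p}\lambda_k|z|^{2(k-1)}\Big)\log G(z)$. A mapping $\Phi$ in $\mathbb{D}$ is polyharmonic if $\Delta^m\Phi=0$ for some $m\ge1$. A univalent (injective) polyharmonic mapping $\Phi$ in $\mathbb{D}$ is called starlike if $\Phi(0)=0$ and $\mathrm{Re}\,\frac{z\Phi_z(z)-\overline z\Phi_{\overline z}(z)}{\Phi(z)}>0$ for all $z\in\mathbb{D}\setminus\{0\}$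 (i.e. $\frac{\partial}{\partial t}\arg\Phi(re^{it})>0$ for each $0<r<1$). *)

(* Defs.v *)
From Stdlib Require Import Reals List.
From Coquelicot Require Import Coquelicot.

Open Scope R_scope.

Definition disk (z : C) : Prop := Cmod z < 1.

Definition univalent (f : C -> C) : Prop :=
  forall z w : C, disk z -> disk w -> f z = f w -> z = w.

Definition nonvanishing (f : C -> C) : Prop :=
  forall z : C, disk z -> f z <> 0%C.

(* Analyticity in the unit disk: a power series expansion near every point. *)
Definition analytic (f : C -> C) : Prop :=
  forall z0 : C, disk z0 ->
    exists (c : nat -> C) (r : posreal),
      forall z : C, Cmod (z - z0)%C < r ->
        is_pseries (K := C_AbsRing) (V := C_NormedModule) c (z - z0)%C (f z).

Definition Cexp (z : C) : C :=
  (exp (Re z) * cos (Im z), exp (Re z) * sin (Im z)).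

Definition ex_Dx (f : C -> C) (z : C) : Prop :=
  ex_derive (fun t => Re (f (t, Im z))) (Re z) /\
  ex_derive (fun t => Im (f (t, Im z))) (Re z).

Definition ex_Dy (f : C -> C) (z : C) : Prop :=
  ex_derive (fun t => Re (f (Re z, t))) (Im z) /\
  ex_derive (fun t => Im (f (Re z, t))) (Im z).

Definition Dx (f : C -> C) (z : C) : C :=
  (Derive (fun t => Re (f (t, Im z))) (Re z),
   Derive (fun t => Im (f (t, Im z))) (Re z)).

Definition Dy (f : C -> C) (z : C) : C :=
  (Derive (fun t => Re (f (Re z, t))) (Im z),
   Derive (fun t => Im (f (Re z, t))) (Im z)).

Definition d_z (f : C -> C) (z : C) : C := ((Dx f z - Ci * Dy f z) / 2)%C.

Definition d_zbar (f : C -> C) (z : C) : C := ((Dx f z + Ci * Dy f z) / 2)%C.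

(* f is of class C^n in the unit disk, as a function of (Re z, Im z). *)
Fixpoint class_C (n : nat) (f : C -> C) : Prop :=
  (forall z : C, disk z ->
     continuous (T := C_UniformSpace) (U := C_UniformSpace) f z) /\
  match n with
  | O => True
  | S m => (forall z : C, disk z -> ex_Dx f z /\ ex_Dy f z) /\
           class_C m (Dx f) /\ class_C m (Dy f)
  end.

Definition laplacian (f : C -> C) (z : C) : C :=
  (Dx (Dx f) z + Dy (Dy f) z)%C.

(* [Derive] is total, with unspecified values where the derivative does not
   exist, so the smoothness needed for the m-th iterate is required
   explicitly. *)
Definition polyharmonic (f : C -> C) : Prop :=
  exists m : nat, (1 <= m)%nat /\ class_C (2 * m) f /\
    forall z : C, disk z -> Nat.iter m laplacian f z = 0%C.

Definition starlike (f : C -> C) : Prop :=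
  univalent f /\ polyharmonic f /\ f 0%C = 0%C /\
  forall z : C, disk z -> z <> 0%C ->
    0 < Re ((z * d_z f z - Cconj z * d_zbar f z) / f z)%C.

Definition log_harmonic_factors (G g1 g2 : C -> C) : Prop :=
  analytic g1 /\ nonvanishing g1 /\ analytic g2 /\ nonvanishing g2 /\
  forall z : C, disk z -> G z = (g1 z * Cconj (g2 z))%C.

(* The factorization in the last clause makes G smooth, so that d_z G and
   d_zbar G are genuine derivatives. *)
Definition nonvanishing_log_harmonic (G : C -> C) : Prop :=
  nonvanishing G /\
  (exists a : C -> C, analytic a /\
     forall z : C, disk z ->
       (Cconj (d_zbar G z) / Cconj (G z))%C = (a z * (d_z G z / G z))%C) /\
  (exists g1 g2 : C -> C, log_harmonic_factors G g1 g2).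

Definition log_branch (g l : C -> C) : Prop :=
  analytic l /\ forall z : C, disk z -> Cexp (l z) = g z.

(* logG = log g1 + conj (log g2) for some choice of analytic branches. *)
Definition log_of_log_harmonic (G logG : C -> C) : Prop :=
  exists g1 g2 l1 l2 : C -> C,
    log_harmonic_factors G g1 g2 /\ log_branch g1 l1 /\ log_branch g2 l2 /\
    forall z : C, disk z -> logG z = (l1 z + Cconj (l2 z))%C.

(* The power G(z)^w determined by the chosen logarithm of G. *)
Definition power (logG : C -> C) (z w : C) : C := Cexp (w * logG z)%C.

Definition exponent (lam : nat -> C) (k : nat) (z : C) : C :=
  (lam k * RtoC (Cmod z ^ (2 * (k - 1))))%C.

Definition exponent_sum (p : nat) (lam : nat -> C) (z : C) : C :=
  sum_n_m (G := C_AbelianMonoid) (fun k => exponent lam k z) 1 p.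

Definition power_product (p : nat) (lam : nat -> C) (logG : C -> C) (z : C)
  : C :=
  fold_right Cmult 1%C
    (map (fun k => power logG z (exponent lam k z)) (seq 1 p)).

(* Main.v *)
(** Put [L f = z f_z - conj z * f_zbar = i (y f_x - x f_y)], i.e. [-i] times the
    derivative along circles centred at 0.  The factor [S = sum lam_k |z|^(2(k-1))]
    is constant on these circles, so [L (log F) = S * L (log G)] and the two
    quotients in the starlikeness conditions agree away from 0.

    Both logarithms are always polyharmonic: [|z|^(2j) (l1 + conj l2)] is a sum
    of terms [f * conj g] with [f], [g] analytic, one of them a monomial of
    degree [j], and [laplacian (f * conj g) = 4 f' * conj g'].

    If [log F] vanishes at 0 but [log G] does not (possible a priori when
    [lam_1 = 0]), then the argument of [log G] is a periodic function of the angle on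
    a small circle, hence has a critical point, where the real part of
    [L (log G) / log G] is 0: so [log F] is not starlike. *)

From Stdlib Require Import Reals List Lra Lia.
From Coquelicot Require Import Coquelicot.
Require Import Defs.

(** * Complex power series *)

Lemma Cmod_INR (n : nat) : Cmod (INR n) = INR n.
Proof. rewrite Cmod_R. apply Rabs_pos_eq, pos_INR. Qed.

(** Induction: the next remainder is [w + h] times the current one plus [(n + 2) w^(n+1) h^2]. The
    constant is twice the sharp one, so that it matches the coefficients of a twice differentiated
    power series. *)
Lemma pow_taylor2_bound (w h : C) (s : R) (n : nat) :
  Cmod w <= s -> Cmod (w + h)%C <= s ->
  Cmod ((w + h) ^ S (S n) - w ^ S (S n) - h * (INR (S (S n)) * w ^ S n))%C
    <= INR (S n) * INR (S (S n)) * s ^ n * Cmod h ^ 2.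
Proof.
intros Hw Hwh.
assert (Hs : 0 <= s) by (eapply Rle_trans; [apply Cmod_ge_0 | exact Hw]).
induction n as [|n IH].
- replace ((w + h) ^ 2 - w ^ 2 - h * (INR 2 * w ^ 1))%C with (h ^ 2)%C
    by (simpl; rewrite !RtoC_plus; ring).
  rewrite Cmod_pow. simpl. generalize (Cmod_ge_0 h); intros; nra.
- replace ((w + h) ^ S (S (S n)) - w ^ S (S (S n))
           - h * (INR (S (S (S n))) * w ^ S (S n)))%C
    with ((w + h) * ((w + h) ^ S (S n) - w ^ S (S n)
            - h * (INR (S (S n)) * w ^ S n))
          + INR (S (S n)) * w ^ S n * h ^ 2)%C
    by (rewrite (S_INR (S (S n))), RtoC_plus, !Cpow_S; simpl; ring).
  eapply Rle_trans; [apply Cmod_triangle|].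
  rewrite !Cmod_mult, !Cmod_pow, Cmod_INR.
  assert (H1 : Cmod w ^ S n <= s ^ S n)
    by (apply pow_incr; split; [apply Cmod_ge_0 | exact Hw]).
  assert (Hh : 0 <= Cmod h ^ 2) by (apply pow_le, Cmod_ge_0).
  assert (Hp : 0 <= s ^ S n) by (apply pow_le; exact Hs).
  apply Rle_trans with
    (s * (INR (S n) * INR (S (S n)) * s ^ n * Cmod h ^ 2)
     + INR (S (S n)) * s ^ S n * Cmod h ^ 2).
  + apply Rplus_le_compat.
    * apply Rmult_le_compat; auto using Cmod_ge_0.
    * apply Rmult_le_compat_r; [exact Hh|].
      apply Rmult_le_compat_l; [apply pos_INR | exact H1].
  + replace (s * (INR (S n) * INR (S (S n)) * s ^ n * Cmod h ^ 2)
     + INR (S (S n)) * s ^ S n * Cmod h ^ 2) with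
     (INR (S (S n)) * (INR (S n) + 1) * (s ^ S n * Cmod h ^ 2)) by (simpl; ring).
    rewrite (Rmult_assoc (_ * _) (s ^ S n)).
    apply Rmult_le_compat_r; [now apply Rmult_le_pos|].
    apply Rmult_le_compat_l; [apply pos_INR|].
    rewrite (S_INR (S (S n))), (S_INR (S n)). lra.
Qed.

Lemma pow_n_Cpow (w : C) (n : nat) : pow_n (K := C_Ring) w n = (w ^ n)%C.
Proof. induction n as [|n IH]; simpl; [reflexivity | now rewrite IH]. Qed.

Definition Cseries (a : nat -> C) (l : C) : Prop :=
  is_series (K := C_AbsRing) (V := C_NormedModule) a l.

Lemma Cpseries_series (c : nat -> C) (w l : C) :
  is_pseries (K := C_AbsRing) (V := C_NormedModule) c w l <->
  Cseries (fun n => c n * w ^ n)%C l.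
Proof.
assert (E : forall n, scal (K := C_AbsRing) (V := C_NormedModule)
              (pow_n (K := C_AbsRing) w n) (c n) = (c n * w ^ n)%C).
{ intros n. change (pow_n (K := C_Ring) w n * c n = c n * w ^ n)%C.
  rewrite pow_n_Cpow. ring. }
split; intros H; (eapply is_series_ext; [|exact H]); intros n;
  [apply E | symmetry; apply E].
Qed.

(** Each term is a difference of two consecutive partial sums, which are bounded because they
    converge. *)
Lemma Cseries_bounded (a : nat -> C) (l : C) :
  Cseries a l -> exists M, forall n, Cmod (a n) <= M.
Proof.
intros H.
destruct (filterlim_bounded (K := C_AbsRing) (V := C_NormedModule)
  (sum_n (G := C_AbelianMonoid) a) (ex_intro _ l H)) as [M HM].
exists (M + M). intros n.
assert (HM' : forall k, Cmod (sum_n (G := C_AbelianMonoid) a k) <= M)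
  by exact HM.
destruct n as [|n].
- generalize (HM' 0%nat) (Cmod_ge_0 (a 0%nat)). rewrite sum_O. lra.
- replace (a (S n)) with (sum_n (G := C_AbelianMonoid) a (S n)
    + - sum_n (G := C_AbelianMonoid) a n)%C.
  + eapply Rle_trans; [apply Cmod_triangle|]. rewrite Cmod_opp.
    now apply Rplus_le_compat.
  + rewrite sum_Sn. change (sum_n (G := C_AbelianMonoid) a n + a (S n)
      + - sum_n (G := C_AbelianMonoid) a n = a (S n))%C. ring.
Qed.

(** Convergence at the single point [rho] bounds [Cmod (c n) * rho ^ n]. This passes from the
    complex series to a real majorant, where the theory of real power series applies. *)
Lemma CV_radius_Cmod (c : nat -> C) (rho : R) (l : C) :
  0 <= rho -> Cseries (fun n => c n * RtoC rho ^ n)%C l ->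
  Rbar_le rho (CV_radius (fun n => Cmod (c n))).
Proof.
intros Hr H. destruct (Cseries_bounded _ _ H) as [M HM].
apply (CV_radius_bounded (fun n => Cmod (c n))).
exists M. intros n. generalize (HM n).
rewrite Cmod_mult, Cmod_pow, Cmod_R, (Rabs_pos_eq rho) by exact Hr.
intros K. rewrite Rabs_pos_eq; [exact K|].
apply Rmult_le_pos; [apply Cmod_ge_0 | now apply pow_le].
Qed.

Lemma Cmod_series_le (a : nat -> C) (l : C) (b : nat -> R) :
  Cseries a l -> (forall n, Cmod (a n) <= b n) -> ex_series b ->
  Cmod l <= Series b.
Proof.
intros Ha Hab Hb.
assert (L1 : is_lim_seq (fun n => norm (sum_n (G := C_AbelianMonoid) a n)) (Cmod l)).
{ exact (filterlim_comp _ _ _ _ _ _ _ _ Ha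
    (filterlim_norm (K := C_AbsRing) (V := C_NormedModule) l)). }
refine (is_lim_seq_le _ (sum_n b) _ (Series b) _ L1 (Series_correct _ Hb)).
intros n. unfold sum_n.
eapply Rle_trans; [apply (norm_sum_n_m (K := C_AbsRing) (V := C_NormedModule))|].
apply sum_n_m_le. exact Hab.
Qed.

(* The remainder is quadratic so that it yields both continuity and the real
   partial derivatives without a separate differentiability notion. *)
Lemma pseries_expansion (c : nat -> C) (r : R) (f : C -> C) :
  (forall w, Cmod w < r -> Cseries (fun n => c n * w ^ n)%C (f w)) ->
  forall w, Cmod w < r -> exists l,
    Cseries (fun n => INR (S n) * c (S n) * w ^ n)%C l /\
    exists K d, 0 <= K /\ 0 < d /\ forall h, Cmod h < d ->
      Cmod (f (w + h) - f w - h * l)%C <= K * Cmod h ^ 2.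
Proof.
intros Hf w Hw.
(* Two radii with [Cmod w < s < rho < r]: convergence at [rho] bounds the radius of the majorant
   from below, and its derived series then converge absolutely at [s], which also bounds [w + h] for
   small [h]. *)
set (s := (Cmod w + (r - Cmod w) / 3)).
set (rho := (Cmod w + 2 * (r - Cmod w) / 3)).
assert (Hs0 := Cmod_ge_0 w).
assert (Hs : Cmod w < s < rho /\ rho < r) by (unfold s, rho; lra).
set (a := fun n => Cmod (c n)).
assert (Hrad : Rbar_lt (Rabs s) (CV_radius a)).
{ rewrite Rabs_pos_eq by lra.
  apply Rbar_lt_le_trans with rho; [simpl; lra|].
  apply (CV_radius_Cmod c rho (f (RtoC rho))); [lra|].
  apply Hf. rewrite Cmod_R, Rabs_pos_eq; lra. }
assert (H1 : ex_series (fun n => Rabs (PS_derive a n * s ^ n))).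
{ apply CV_disk_inside. now rewrite CV_radius_derive. }
assert (H2 : ex_series (fun n => Rabs (PS_derive (PS_derive a) n * s ^ n))).
{ apply CV_disk_inside. now rewrite !CV_radius_derive. }
assert (Hex : exists l : C, Cseries (fun n => INR (S n) * c (S n) * w ^ n)%C l).
{ apply (ex_series_le (K := C_AbsRing) (V := C_CompleteNormedModule)
    (fun n => INR (S n) * c (S n) * w ^ n)%C
    (fun n => Rabs (PS_derive a n * s ^ n))); [|exact H1].
  intros n.
  change (Cmod (INR (S n) * c (S n) * w ^ n)%C <= Rabs (PS_derive a n * s ^ n)).
  rewrite !Cmod_mult, Cmod_INR, Cmod_pow.
  eapply Rle_trans; [|apply Rle_abs]. unfold PS_derive, a.
  apply Rmult_le_compat.
  - apply Rmult_le_pos; [apply pos_INR | apply Cmod_ge_0].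
  - apply pow_le, Cmod_ge_0.
  - apply Rle_refl.
  - apply pow_incr. lra. }
destruct Hex as [l Hl].
exists l. split; [exact Hl|].
set (b := fun n => Rabs (PS_derive (PS_derive a) n * s ^ n)) in *.
exists (Series b), (s - Cmod w).
split; [|split; [lra|]].
(* Writing 0 as a series lets termwise comparison give [0 <= Series b]. *)
{ replace 0 with (Series (fun _ => 0 * 0)) by (rewrite Series_scal_l; ring).
  apply Series_le; [|exact H2].
  intros n; split; [lra|]. rewrite Rmult_0_l. apply Rabs_pos. }
intros h Hh.
assert (Hwh : Cmod (w + h)%C < s)
  by (generalize (Cmod_triangle w h); lra).
(* The termwise first-order remainders. Those of index 0 and 1 vanish ([pred 0] comes with the
   factor [INR 0]), so the sum may start at 2, where [pow_taylor2_bound] applies. *)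
set (D := fun n => (c n * (w + h) ^ n - c n * w ^ n
                    - h * (INR n * c n * w ^ pred n))%C).
assert (HD : Cseries D (f (w + h) - f w - h * l)%C).
{ unfold Cseries. apply (is_series_minus (K := C_AbsRing) (V := C_NormedModule)).
  - apply (is_series_minus (K := C_AbsRing) (V := C_NormedModule)); apply Hf; lra.
  - apply (is_series_scal (K := C_AbsRing) (V := C_NormedModule) h).
    apply is_series_decr_1.
    match goal with |- is_series _ ?x => replace x with l end; [exact Hl|].
    change (l = l + - (INR 0 * c 0%nat * w ^ pred 0))%C. simpl. ring. }
rewrite Rmult_comm, <- Series_scal_l.
apply Cmod_series_le with (fun n => D (2 + n)%nat).
- apply (is_series_incr_n (K := C_AbsRing) (V := C_NormedModule) D 2); [lia|].
  match goal with |- is_series _ ?x =>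
    replace x with (f (w + h) - f w - h * l)%C end; [exact HD|].
  simpl. rewrite sum_Sn, sum_O.
  change (f (w + h) - f w - h * l = (f (w + h) - f w - h * l) + (D 0%nat + D 1%nat))%C.
  unfold D. simpl. ring.
- intros n. unfold D. simpl pred.
  replace (c (2 + n)%nat * (w + h) ^ (2 + n) - c (2 + n)%nat * w ^ (2 + n)
     - h * (INR (2 + n) * c (2 + n)%nat * w ^ S n))%C
  with (c (S (S n)) * ((w + h) ^ S (S n) - w ^ S (S n)
     - h * (INR (S (S n)) * w ^ S n)))%C by (change (2 + n)%nat with (S (S n)); ring).
  rewrite Cmod_mult. unfold b.
  apply Rle_trans with (Cmod h ^ 2 * (PS_derive (PS_derive a) n * s ^ n)).
  + unfold PS_derive, a.
    eapply Rle_trans; [apply Rmult_le_compat_l; [apply Cmod_ge_0|]|].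
    * apply (pow_taylor2_bound w h s n); lra.
    * right. ring.
  + apply Rmult_le_compat_l; [apply pow_le, Cmod_ge_0 | apply Rle_abs].
- apply (ex_series_scal (K := R_AbsRing) (V := R_NormedModule)). exact H2.
Qed.

(** * Partial derivatives of analytic functions *)

(** The uniform structure on [C] is that of the product, with squares as balls; squares and discs
    are comparable up to the factor [sqrt 2]. *)
Lemma locally_Cmod (z : C) (P : C -> Prop) :
  locally (T := C_UniformSpace) z P <->
  exists d, 0 < d /\ forall w, Cmod (w - z)%C < d -> P w.
Proof.
split.
- intros [e He]. exists e. split; [apply cond_pos|].
  intros w Hw. apply He. now apply C_NormedModule_mixin_compat1.
- intros [d [Hd H]].
  assert (H2 : 0 < sqrt 2) by (apply sqrt_lt_R0; lra).
  exists (mkposreal (d / sqrt 2) (Rdiv_lt_0_compat _ _ Hd H2)).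
  intros w Hw. apply H. apply C_NormedModule_mixin_compat2 in Hw.
  simpl in Hw. replace d with (sqrt 2 * (d / sqrt 2)) by (field; lra).
  exact Hw.
Qed.

Lemma continuous_Cmod (f : C -> C) (z : C) :
  continuous (T := C_UniformSpace) (U := C_UniformSpace) f z <->
  forall e, 0 < e -> exists d, 0 < d /\
    forall w, Cmod (w - z)%C < d -> Cmod (f w - f z)%C < e.
Proof.
split.
- intros H e He. apply locally_Cmod.
  apply (H (fun y => Cmod (y - f z)%C < e)).
  apply locally_Cmod. now exists e.
- intros H P HP. apply locally_Cmod in HP. destruct HP as [e [He HP]].
  apply locally_Cmod. destruct (H e He) as [d [Hd Hw]].
  exists d. split; [exact Hd|]. intros w Hdw. now apply HP, Hw.
Qed.

Lemma disk_locally (z : C) : disk z -> locally (T := C_UniformSpace) z disk.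
Proof.
intros Hz. apply locally_Cmod. exists (1 - Cmod z). unfold disk in *.
split; [lra|]. intros w Hw.
replace w with ((w - z) + z)%C by ring.
eapply Rle_lt_trans; [apply Cmod_triangle|]. lra.
Qed.

Definition Cder (phi : R -> C) (t : R) (l : C) : Prop :=
  is_derive (fun s : R => Re (phi s)) t (Re l) /\
  is_derive (fun s : R => Im (phi s)) t (Im l).

Definition has_Dx (f : C -> C) (z l : C) : Prop :=
  Cder (fun t => f (t, Im z)) (Re z) l.

Definition has_Dy (f : C -> C) (z l : C) : Prop :=
  Cder (fun t => f (Re z, t)) (Im z) l.

Lemma has_Dx_unique (f : C -> C) (z l : C) : has_Dx f z l -> Dx f z = l.
Proof.
intros [H1 H2]. unfold Dx.
rewrite (is_derive_unique _ _ _ H1), (is_derive_unique _ _ _ H2).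
now destruct l.
Qed.

Lemma has_Dy_unique (f : C -> C) (z l : C) : has_Dy f z l -> Dy f z = l.
Proof.
intros [H1 H2]. unfold Dy.
rewrite (is_derive_unique _ _ _ H1), (is_derive_unique _ _ _ H2).
now destruct l.
Qed.

Lemma has_Dx_ex (f : C -> C) (z l : C) : has_Dx f z l -> ex_Dx f z.
Proof. intros [H1 H2]. split; eexists; eassumption. Qed.

Lemma has_Dy_ex (f : C -> C) (z l : C) : has_Dy f z l -> ex_Dy f z.
Proof. intros [H1 H2]. split; eexists; eassumption. Qed.

Lemma ex_Dx_has (f : C -> C) (z : C) : ex_Dx f z -> has_Dx f z (Dx f z).
Proof. intros [H1 H2]. split; now apply Derive_correct. Qed.

Lemma ex_Dy_has (f : C -> C) (z : C) : ex_Dy f z -> has_Dy f z (Dy f z).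
Proof. intros [H1 H2]. split; now apply Derive_correct. Qed.

Lemma Cder_ext_loc (phi psi : R -> C) (t : R) (l : C) :
  locally t (fun s => phi s = psi s) -> Cder phi t l -> Cder psi t l.
Proof.
intros E [H1 H2]. split; (eapply is_derive_ext_loc; [|eassumption]);
  revert E; apply filter_imp; intros s ->; reflexivity.
Qed.

Lemma Cder_plus (phi psi : R -> C) (t : R) (l m : C) :
  Cder phi t l -> Cder psi t m -> Cder (fun s => phi s + psi s)%C t (l + m)%C.
Proof.
intros [H1 H2] [H3 H4]. split.
- apply (is_derive_plus (V := R_NormedModule) _ _ _ _ _ H1 H3).
- apply (is_derive_plus (V := R_NormedModule) _ _ _ _ _ H2 H4).
Qed.

Lemma Cder_mult (phi psi : R -> C) (t : R) (l m : C) :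
  Cder phi t l -> Cder psi t m ->
  Cder (fun s => phi s * psi s)%C t (l * psi t + phi t * m)%C.
Proof.
intros [H1 H2] [H3 H4].
assert (Hc : forall n m : R_AbsRing, mult n m = mult m n) by exact Rmult_comm.
split.
- generalize (is_derive_minus (V := R_NormedModule) _ _ _ _ _
    (is_derive_mult _ _ _ _ _ H1 H3 Hc) (is_derive_mult _ _ _ _ _ H2 H4 Hc)).
  intros H. eapply is_derive_ext; [|evar_last; [exact H|]].
  + intros s. reflexivity.
  + unfold minus, plus, opp, mult; simpl. unfold Re, Im. ring.
- generalize (is_derive_plus (V := R_NormedModule) _ _ _ _ _
    (is_derive_mult _ _ _ _ _ H1 H4 Hc) (is_derive_mult _ _ _ _ _ H2 H3 Hc)).
  intros H. eapply is_derive_ext; [|evar_last; [exact H|]].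
  + intros s. reflexivity.
  + unfold minus, plus, opp, mult; simpl. unfold Re, Im. ring.
Qed.

Lemma Cder_conj (phi : R -> C) (t : R) (l : C) :
  Cder phi t l -> Cder (fun s => Cconj (phi s)) t (Cconj l).
Proof.
intros [H1 H2]. split; [exact H1|].
apply (is_derive_opp (V := R_NormedModule) _ _ _ H2).
Qed.

Lemma Cder_const (c : C) (t : R) : Cder (fun _ => c) t 0%C.
Proof. split; apply (is_derive_const (V := R_NormedModule)). Qed.

Lemma is_derive_quadratic (phi : R -> R) (t l K d : R) :
  0 <= K -> 0 < d ->
  (forall h, Rabs h < d -> Rabs (phi (t + h) - phi t - h * l) <= K * h ^ 2) ->
  is_derive phi t l.
Proof.
intros HK Hd H. apply is_derive_Reals. intros e He.
(* The error of the difference quotient is at most [K * Rabs h]; dividing by [K + 1] also covers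
   [K = 0]. *)
assert (He' : 0 < e / (K + 1)) by (apply Rdiv_lt_0_compat; lra).
exists (mkposreal (Rmin d (e / (K + 1))) (Rmin_pos _ _ Hd He')).
simpl. intros h Hh0 Hh.
assert (Hh1 : Rabs h < d) by (eapply Rlt_le_trans; [exact Hh | apply Rmin_l]).
assert (Hh2 : Rabs h < e / (K + 1))
  by (eapply Rlt_le_trans; [exact Hh | apply Rmin_r]).
assert (Hp := Rabs_pos_lt _ Hh0).
replace ((phi (t + h) - phi t) / h - l) with
  ((phi (t + h) - phi t - h * l) / h) by (field; exact Hh0).
rewrite Rabs_div by exact Hh0.
apply Rmult_lt_reg_r with (Rabs h); [exact Hp|].
unfold Rdiv. rewrite Rmult_assoc, Rinv_l, Rmult_1_r by lra.
eapply Rle_lt_trans; [apply H; exact Hh1|].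
rewrite <- (pow2_abs h).
apply Rmult_lt_compat_r with (r := K + 1) in Hh2; [|lra].
replace (e / (K + 1) * (K + 1)) with e in Hh2 by (field; lra). nra.
Qed.

Lemma Cder_quadratic (phi : R -> C) (t K d : R) (l : C) :
  0 <= K -> 0 < d ->
  (forall h, Rabs h < d ->
     Cmod (phi (t + h)%R - phi t - h * l)%C <= K * h ^ 2) ->
  Cder phi t l.
Proof.
intros HK Hd H. split; apply is_derive_quadratic with K d; trivial;
  intros h Hh; (eapply Rle_trans; [|apply H; exact Hh]);
  (eapply Rle_trans; [|apply Rmax_Cmod]).
- eapply Rle_trans; [|apply Rmax_l]. right. f_equal.
  unfold Re. simpl. ring.
- eapply Rle_trans; [|apply Rmax_r]. right. f_equal.
  unfold Im. simpl. ring.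
Qed.

(** The Cauchy-Riemann form of a complex derivative [l]: [f_x = l] and [f_y = i l]. Continuity is
    listed separately because partial derivatives at a point do not imply it. *)
Definition complex_diff (f : C -> C) (z l : C) : Prop :=
  continuous (T := C_UniformSpace) (U := C_UniformSpace) f z /\
  has_Dx f z l /\ has_Dy f z (Ci * l)%C.

Lemma complex_diff_quadratic (f : C -> C) (z l : C) (K d : R) :
  0 <= K -> 0 < d ->
  (forall h, Cmod h < d -> Cmod (f (z + h) - f z - h * l)%C <= K * Cmod h ^ 2) ->
  complex_diff f z l.
Proof.
intros HK Hd H. split; [|split].
- apply continuous_Cmod. intros e He.
  assert (Hl := Cmod_ge_0 l).
  (* On the ball of radius [d] the increment of [f] is at most [A] times the distance to [z]; the
     summand 1 makes [A] positive. *)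
  set (A := K * d + Cmod l + 1).
  assert (HA : 0 < A) by (unfold A; nra).
  assert (He' : 0 < e / A) by (apply Rdiv_lt_0_compat; lra).
  exists (Rmin d (e / A)). split; [now apply Rmin_pos|].
  intros w Hw.
  assert (Hh1 : Cmod (w - z)%C < d) by (eapply Rlt_le_trans; [exact Hw | apply Rmin_l]).
  assert (Hh2 : Cmod (w - z)%C < e / A)
    by (eapply Rlt_le_trans; [exact Hw | apply Rmin_r]).
  specialize (H _ Hh1). replace (z + (w - z))%C with w in H by ring.
  replace (f w - f z)%C with ((f w - f z - (w - z) * l) + (w - z) * l)%C by ring.
  eapply Rle_lt_trans; [apply Cmod_triangle|]. rewrite Cmod_mult.
  assert (Hp := Cmod_ge_0 (w - z)%C).
  apply Rle_lt_trans with (Cmod (w - z)%C * A).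
  + assert (HKx := Rmult_le_pos _ _ HK Hp).
    apply Rlt_le in Hh1. apply Rmult_le_compat_l with (1 := HKx) in Hh1.
    unfold A. nra.
  + apply Rmult_lt_compat_r with (r := A) in Hh2; [|lra].
    replace (e / A * A) with e in Hh2 by (field; lra). exact Hh2.
- apply Cder_quadratic with K d; trivial. intros h Hh.
  rewrite <- (pow2_abs h), <- Cmod_R. rewrite <- Cmod_R in Hh.
  specialize (H _ Hh).
  replace (z + h)%C with (Re z + h, Im z) in H
    by (destruct z; apply injective_projections; simpl; ring).
  now destruct z.
- apply Cder_quadratic with K d; trivial. intros h Hh.
  assert (Ehi : Cmod (h * Ci)%C = Rabs h)
    by (rewrite Cmod_mult, Cmod_Ci, Cmod_R; ring).
  rewrite <- (pow2_abs h). rewrite <- Ehi in Hh |- *.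
  specialize (H _ Hh).
  replace (z + h * Ci)%C with (Re z, Im z + h) in H
    by (destruct z; apply injective_projections; simpl; ring).
  rewrite Cmult_assoc. now destruct z.
Qed.

(** The differentiated series about the same centre converges to the complex derivative, which
    equals the partial derivative in x. Hence [Dx] serves as complex differentiation and can be
    iterated. *)
Lemma analytic_deriv (f : C -> C) :
  analytic f ->
  analytic (Dx f) /\ forall z, disk z -> complex_diff f z (Dx f z).
Proof.
intros Hf.
assert (Hstep : forall z0, disk z0 -> exists (c : nat -> C) (r : posreal),
  forall z, Cmod (z - z0)%C < r ->
    Cseries (fun n => INR (S n) * c (S n) * (z - z0) ^ n)%C (Dx f z) /\
    complex_diff f z (Dx f z)).
{ intros z0 Hz0. destruct (Hf z0 Hz0) as [c [r H]].
  exists c, r. intros z Hz.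
  destruct (pseries_expansion c r (fun w => f (z0 + w)%C)) with (w := (z - z0)%C)
    as [l [Hl [K [d [HK [Hd Hq]]]]]]; [|exact Hz|].
  { intros w Hw. apply Cpseries_series.
    specialize (H (z0 + w)%C). replace (z0 + w - z0)%C with w in H by ring.
    now apply H. }
  assert (Hc : complex_diff f z l).
  { apply complex_diff_quadratic with K d; trivial.
    intros h Hh. generalize (Hq h Hh).
    replace (z0 + (z - z0 + h))%C with (z + h)%C by ring.
    now replace (z0 + (z - z0))%C with z by ring. }
  rewrite (has_Dx_unique f z l) by apply Hc. now split. }
split.
- intros z0 Hz0. destruct (Hstep z0 Hz0) as [c [r H]].
  exists (fun n => INR (S n) * c (S n))%C, r.
  intros z Hz. apply Cpseries_series. now apply H.
- intros z Hz. destruct (Hstep z Hz) as [c [r H]].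
  apply H. replace (z - z)%C with (RtoC 0) by ring.
  rewrite Cmod_0. apply cond_pos.
Qed.

(** The successive complex derivatives of [fs 0] are carried as data, so that products and multiples
    can be given explicit formulas for all their derivatives. *)
Definition jet (fs : nat -> C -> C) : Prop :=
  forall n z, disk z -> complex_diff (fs n) z (fs (S n) z).

Lemma analytic_jet (f : C -> C) :
  analytic f -> exists fs, jet fs /\ fs 0%nat = f.
Proof.
intros Hf. exists (fun n => Nat.iter n Dx f). split; [|reflexivity].
assert (H : forall n, analytic (Nat.iter n Dx f)).
{ induction n as [|n IH]; simpl; [exact Hf | now apply analytic_deriv]. }
intros n z Hz. simpl. now apply analytic_deriv.
Qed.

(** * Iterated Laplacians *)

(** Values outside the disk are unconstrained; since the disk is open, derivatives inside it depend
    only on the values there. *)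
Definition eq_on_disk (f g : C -> C) : Prop :=
  forall z : C, disk z -> f z = g z.

Lemma disk_locally_x (z : C) :
  disk z -> locally (Re z) (fun s : R => disk (s, Im z)).
Proof.
intros Hz. destruct (disk_locally z Hz) as [e He].
exists e. intros s Hs. apply He. split; [exact Hs | apply ball_center].
Qed.

Lemma disk_locally_y (z : C) :
  disk z -> locally (Im z) (fun s : R => disk (Re z, s)).
Proof.
intros Hz. destruct (disk_locally z Hz) as [e He].
exists e. intros s Hs. apply He. split; [apply ball_center | exact Hs].
Qed.

Lemma has_Dx_ext (f g : C -> C) (z l : C) :
  eq_on_disk f g -> disk z -> has_Dx f z l -> has_Dx g z l.
Proof.
intros E Hz. apply Cder_ext_loc.
generalize (disk_locally_x z Hz). apply filter_imp. intros s. apply E.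
Qed.

Lemma has_Dy_ext (f g : C -> C) (z l : C) :
  eq_on_disk f g -> disk z -> has_Dy f z l -> has_Dy g z l.
Proof.
intros E Hz. apply Cder_ext_loc.
generalize (disk_locally_y z Hz). apply filter_imp. intros s. apply E.
Qed.

Lemma Dx_ext (f g : C -> C) : eq_on_disk f g -> eq_on_disk (Dx f) (Dx g).
Proof.
intros E z Hz. unfold Dx. f_equal; apply Derive_ext_loc;
  generalize (disk_locally_x z Hz); apply filter_imp; intros s Hs;
  now rewrite E.
Qed.

Lemma Dy_ext (f g : C -> C) : eq_on_disk f g -> eq_on_disk (Dy f) (Dy g).
Proof.
intros E z Hz. unfold Dy. f_equal; apply Derive_ext_loc;
  generalize (disk_locally_y z Hz); apply filter_imp; intros s Hs;
  now rewrite E.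
Qed.

Lemma continuous_ext_disk (f g : C -> C) (z : C) :
  eq_on_disk f g -> disk z ->
  continuous (T := C_UniformSpace) (U := C_UniformSpace) f z ->
  continuous (T := C_UniformSpace) (U := C_UniformSpace) g z.
Proof.
intros E Hz. apply continuous_ext_loc.
generalize (disk_locally z Hz). apply filter_imp. exact E.
Qed.

Lemma class_C_ext (n : nat) (f g : C -> C) :
  eq_on_disk f g -> class_C n f -> class_C n g.
Proof.
revert f g; induction n as [|n IH]; intros f g E [Hc Hd]; split.
- intros z Hz. apply (continuous_ext_disk f); auto.
- exact I.
- intros z Hz. apply (continuous_ext_disk f); auto.
- destruct Hd as [Hd [Hx Hy]]. split; [|split].
  + intros z Hz. destruct (Hd z Hz) as [H1 H2]. split.
    * apply has_Dx_ex with (Dx f z), (has_Dx_ext f); auto using ex_Dx_has.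
    * apply has_Dy_ex with (Dy f z), (has_Dy_ext f); auto using ex_Dy_has.
  + apply (IH (Dx f)); [now apply Dx_ext | exact Hx].
  + apply (IH (Dy f)); [now apply Dy_ext | exact Hy].
Qed.

Lemma Dx_plus (f g : C -> C) (z : C) :
  ex_Dx f z -> ex_Dx g z -> has_Dx (fun w => f w + g w)%C z (Dx f z + Dx g z)%C.
Proof. intros Hf Hg. now apply Cder_plus; apply ex_Dx_has. Qed.

Lemma Dy_plus (f g : C -> C) (z : C) :
  ex_Dy f z -> ex_Dy g z -> has_Dy (fun w => f w + g w)%C z (Dy f z + Dy g z)%C.
Proof. intros Hf Hg. now apply Cder_plus; apply ex_Dy_has. Qed.

Lemma continuous_plus_C (f g : C -> C) (z : C) :
  continuous (T := C_UniformSpace) (U := C_UniformSpace) f z ->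
  continuous (T := C_UniformSpace) (U := C_UniformSpace) g z ->
  continuous (T := C_UniformSpace) (U := C_UniformSpace) (fun w => f w + g w)%C z.
Proof.
exact (continuous_plus (U := C_UniformSpace) (V := C_R_NormedModule) f g z).
Qed.

Lemma continuous_mult_C (f g : C -> C) (z : C) :
  continuous (T := C_UniformSpace) (U := C_UniformSpace) f z ->
  continuous (T := C_UniformSpace) (U := C_UniformSpace) g z ->
  continuous (T := C_UniformSpace) (U := C_UniformSpace) (fun w => f w * g w)%C z.
Proof.
rewrite !continuous_Cmod. intros Hf Hg e He.
assert (H0 := Cmod_ge_0 (f z)). assert (H1 := Cmod_ge_0 (g z)).
(* The three error terms below are bounded by [m] times the three summands of [A]; for the product
   of both increments this uses [m <= 1]. *)
set (A := Cmod (f z) + Cmod (g z) + 1).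
assert (Hd : 0 < Rmin 1 (e / A))
  by (apply Rmin_pos; [lra | apply Rdiv_lt_0_compat; unfold A; lra]).
destruct (Hf _ Hd) as [d1 [Hd1 H2]]. destruct (Hg _ Hd) as [d2 [Hd2 H3]].
exists (Rmin d1 d2). split; [now apply Rmin_pos|]. intros w Hw.
specialize (H2 w (Rlt_le_trans _ _ _ Hw (Rmin_l _ _))).
specialize (H3 w (Rlt_le_trans _ _ _ Hw (Rmin_r _ _))).
replace (f w * g w - f z * g z)%C
  with ((f w - f z) * (g w - g z) + (f w - f z) * g z + f z * (g w - g z))%C by ring.
eapply Rle_lt_trans; [apply Cmod_triangle|].
eapply Rle_lt_trans; [apply Rplus_le_compat_r, Cmod_triangle|].
rewrite !Cmod_mult.
set (a := Cmod (f w - f z)%C) in *. set (b := Cmod (g w - g z)%C) in *.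
assert (Ha : 0 <= a) by apply Cmod_ge_0. assert (Hb : 0 <= b) by apply Cmod_ge_0.
set (m := Rmin 1 (e / A)) in *.
assert (Hm1 : m <= 1) by apply Rmin_l.
assert (Hm2 : m * A <= e).
{ replace e with (e / A * A) by (field; unfold A; lra).
  apply Rmult_le_compat_r; [unfold A; lra | apply Rmin_r]. }
apply Rlt_le_trans with (m * A); [|exact Hm2]. unfold A.
assert (a * b < m * 1) by (apply Rmult_le_0_lt_compat; lra).
assert (a * Cmod (g z) <= m * Cmod (g z)) by (apply Rmult_le_compat_r; lra).
assert (Cmod (f z) * b <= Cmod (f z) * m) by (apply Rmult_le_compat_l; lra).
lra.
Qed.

Lemma continuous_conj_C (f : C -> C) (z : C) :
  continuous (T := C_UniformSpace) (U := C_UniformSpace) f z ->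
  continuous (T := C_UniformSpace) (U := C_UniformSpace) (fun w => Cconj (f w)) z.
Proof.
rewrite !continuous_Cmod. intros Hf e He.
destruct (Hf e He) as [d [Hd H]]. exists d. split; [exact Hd|].
intros w Hw. rewrite <- Cminus_conj, Cmod_conj. now apply H.
Qed.

Lemma class_C_plus (n : nat) (f g : C -> C) :
  class_C n f -> class_C n g -> class_C n (fun z => f z + g z)%C.
Proof.
revert f g; induction n as [|n IH]; intros f g [Hfc Hf] [Hgc Hg]; split.
- intros z Hz. apply continuous_plus_C; auto.
- exact I.
- intros z Hz. apply continuous_plus_C; auto.
- destruct Hf as [Hf [Hfx Hfy]], Hg as [Hg [Hgx Hgy]].
  assert (Hx : forall z, disk z ->
    has_Dx (fun w => f w + g w)%C z (Dx f z + Dx g z)%C)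
    by (intros z Hz; apply Dx_plus; [apply Hf | apply Hg]; exact Hz).
  assert (Hy : forall z, disk z ->
    has_Dy (fun w => f w + g w)%C z (Dy f z + Dy g z)%C)
    by (intros z Hz; apply Dy_plus; [apply Hf | apply Hg]; exact Hz).
  split; [|split].
  + intros z Hz. split; [eapply has_Dx_ex, Hx | eapply has_Dy_ex, Hy]; exact Hz.
  + eapply class_C_ext; [|exact (IH _ _ Hfx Hgx)].
    intros z Hz. symmetry. now apply has_Dx_unique, Hx.
  + eapply class_C_ext; [|exact (IH _ _ Hfy Hgy)].
    intros z Hz. symmetry. now apply has_Dy_unique, Hy.
Qed.

Lemma class_C_laplacian (n : nat) (f : C -> C) :
  class_C (S (S n)) f -> class_C n (laplacian f).
Proof.
intros [_ [_ [[_ [_ [Hx _]]] [_ [_ [_ Hy]]]]]].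
exact (class_C_plus n _ _ Hx Hy).
Qed.

Lemma laplacian_ext (f g : C -> C) :
  eq_on_disk f g -> eq_on_disk (laplacian f) (laplacian g).
Proof.
intros E z Hz. unfold laplacian.
now rewrite (Dx_ext _ _ (Dx_ext _ _ E) z Hz), (Dy_ext _ _ (Dy_ext _ _ E) z Hz).
Qed.

Lemma iter_laplacian_ext (m : nat) (f g : C -> C) :
  eq_on_disk f g -> eq_on_disk (Nat.iter m laplacian f) (Nat.iter m laplacian g).
Proof.
intros E. induction m as [|m IH]; simpl; [exact E | now apply laplacian_ext].
Qed.

Lemma laplacian_plus (f g : C -> C) :
  class_C 2 f -> class_C 2 g ->
  eq_on_disk (laplacian (fun z => f z + g z)%C)
             (fun z => laplacian f z + laplacian g z)%C.
Proof.
intros [_ [Hf [[_ [Hfx _]] [_ [Hfy _]]]]] [_ [Hg [[_ [Hgx _]] [_ [Hgy _]]]]].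
intros z Hz. unfold laplacian.
rewrite (Dx_ext (Dx (fun w => f w + g w)%C) (fun w => Dx f w + Dx g w)%C);
  [| intros w Hw; apply has_Dx_unique, Dx_plus; [apply Hf | apply Hg]; exact Hw
   | exact Hz].
rewrite (Dy_ext (Dy (fun w => f w + g w)%C) (fun w => Dy f w + Dy g w)%C);
  [| intros w Hw; apply has_Dy_unique, Dy_plus; [apply Hf | apply Hg]; exact Hw
   | exact Hz].
rewrite (has_Dx_unique _ _ _ (Dx_plus _ _ z (proj1 (Hfx z Hz)) (proj1 (Hgx z Hz)))).
rewrite (has_Dy_unique _ _ _ (Dy_plus _ _ z (proj2 (Hfy z Hz)) (proj2 (Hgy z Hz)))).
ring.
Qed.

Lemma class_C_le (n m : nat) (f : C -> C) :
  (n <= m)%nat -> class_C m f -> class_C n f.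
Proof.
revert m f; induction n as [|n IH]; intros m f Hnm H.
- destruct m; split; [apply H | exact I | apply H | exact I].
- destruct m as [|m]; [lia|].
  destruct H as [Hc [Hd [Hx Hy]]].
  split; [exact Hc|]. split; [exact Hd|].
  split; apply (IH m); trivial; lia.
Qed.

(** The order is explicit so that functions of the same order can be added. *)
Definition polyharmonic_order (m : nat) (f : C -> C) : Prop :=
  class_C (2 * m) f /\ forall z : C, disk z -> Nat.iter m laplacian f z = 0%C.

Lemma polyharmonic_order_ext (m : nat) (f g : C -> C) :
  eq_on_disk f g -> polyharmonic_order m f -> polyharmonic_order m g.
Proof.
intros E [H1 H2]. split; [now apply (class_C_ext _ f)|].
intros z Hz. rewrite <- (iter_laplacian_ext m f g E z Hz). now apply H2.
Qed.

Lemma polyharmonic_order_plus (m : nat) (f g : C -> C) :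
  polyharmonic_order m f -> polyharmonic_order m g ->
  polyharmonic_order m (fun z => f z + g z)%C.
Proof.
intros [Hf Hf0] [Hg Hg0]. split; [now apply class_C_plus|].
intros z Hz.
enough (E : eq_on_disk (Nat.iter m laplacian (fun z => f z + g z)%C)
  (fun z => Nat.iter m laplacian f z + Nat.iter m laplacian g z)%C)
  by (rewrite (E z Hz), Hf0, Hg0 by exact Hz; ring).
clear Hf0 Hg0 z Hz. revert f g Hf Hg; induction m as [|m IH]; intros f g Hf Hg.
- now intros z Hz.
(* Each Laplacian uses up two orders of smoothness; the innermost one is split off. *)
- replace (2 * S m)%nat with (S (S (2 * m))) in Hf, Hg by lia.
  intros z Hz. rewrite !Nat.iter_succ_r.
  rewrite (iter_laplacian_ext m _ (fun z => laplacian f z + laplacian g z)%C);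
    [| apply laplacian_plus; (eapply class_C_le; [|eassumption]); lia | exact Hz].
  apply IH; trivial; now apply class_C_laplacian.
Qed.

(** * Products of an analytic and an antianalytic function *)

Lemma complex_diff_const_mult (c : C) (f : C -> C) (z l : C) :
  complex_diff f z l -> complex_diff (fun w => c * f w)%C z (c * l)%C.
Proof.
intros [Hc [Hx Hy]]. split; [|split].
- apply continuous_mult_C; [apply continuous_const | exact Hc].
- unfold has_Dx. replace (c * l)%C with (0 * f (Re z, Im z) + c * l)%C by ring.
  apply (Cder_mult (fun _ => c)); [apply Cder_const | exact Hx].
- unfold has_Dy.
  replace (Ci * (c * l))%C with (0 * f (Re z, Im z) + c * (Ci * l))%C by ring.
  apply (Cder_mult (fun _ => c)); [apply Cder_const | exact Hy].
Qed.

Lemma jet_const_mult (c : C) (fs : nat -> C -> C) :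
  jet fs -> jet (fun n z => c * fs n z)%C.
Proof. intros H n z Hz. now apply complex_diff_const_mult, H. Qed.

Lemma jet_shift (fs : nat -> C -> C) : jet fs -> jet (fun n => fs (S n)).
Proof. intros H n z Hz. now apply H. Qed.

Lemma has_Dx_mult_conj (f g : C -> C) (z l m : C) :
  complex_diff f z l -> complex_diff g z m ->
  has_Dx (fun w => f w * Cconj (g w))%C z (l * Cconj (g z) + f z * Cconj m)%C.
Proof.
intros [_ [Hf _]] [_ [Hg _]].
generalize (Cder_mult _ _ _ _ _ Hf (Cder_conj _ _ _ Hg)). now destruct z.
Qed.

Lemma has_Dy_mult_conj (f g : C -> C) (z l m : C) :
  complex_diff f z l -> complex_diff g z m ->
  has_Dy (fun w => f w * Cconj (g w))%C z
    (Ci * l * Cconj (g z) + f z * Cconj (Ci * m))%C.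
Proof.
intros [_ [_ Hf]] [_ [_ Hg]].
generalize (Cder_mult _ _ _ _ _ Hf (Cder_conj _ _ _ Hg)). now destruct z.
Qed.

(** Both partial derivatives are sums of two products of the same kind, with one jet shifted and
    possibly multiplied by [Ci]; hence the induction over all jets. *)
Lemma class_C_mult_conj (n : nat) (fs gs : nat -> C -> C) :
  jet fs -> jet gs -> class_C n (fun z => fs 0%nat z * Cconj (gs 0%nat z))%C.
Proof.
revert fs gs; induction n as [|n IH]; intros fs gs Hf Hg.
- split; [|exact I]. intros z Hz. apply continuous_mult_C; [now apply Hf|].
  now apply continuous_conj_C, Hg.
- split; [intros z Hz; apply continuous_mult_C; [now apply Hf|];
          now apply continuous_conj_C, Hg|].
  split; [|split].
  + intros z Hz. split.
    * eapply has_Dx_ex, has_Dx_mult_conj; [apply Hf | apply Hg]; exact Hz.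
    * eapply has_Dy_ex, has_Dy_mult_conj; [apply Hf | apply Hg]; exact Hz.
  + eapply class_C_ext;
      [|apply (class_C_plus n _ _ (IH _ _ (jet_shift _ Hf) Hg)
                (IH _ _ Hf (jet_shift _ Hg)))].
    intros z Hz. symmetry.
    apply has_Dx_unique, has_Dx_mult_conj; [apply Hf | apply Hg]; exact Hz.
  + eapply class_C_ext;
      [|apply (class_C_plus n _ _
          (IH _ _ (jet_const_mult Ci _ (jet_shift _ Hf)) Hg)
          (IH _ _ Hf (jet_const_mult Ci _ (jet_shift _ Hg))))].
    intros z Hz. symmetry.
    apply has_Dy_unique, has_Dy_mult_conj; [apply Hf | apply Hg]; exact Hz.
Qed.

Lemma laplacian_mult_conj (fs gs : nat -> C -> C) :
  jet fs -> jet gs ->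
  eq_on_disk (laplacian (fun z => fs 0%nat z * Cconj (gs 0%nat z))%C)
             (fun z => 4 * fs 1%nat z * Cconj (gs 1%nat z))%C.
Proof.
intros Hf Hg z Hz. unfold laplacian.
assert (Hx : eq_on_disk (Dx (fun z => fs 0%nat z * Cconj (gs 0%nat z))%C)
  (fun z => fs 1%nat z * Cconj (gs 0%nat z) + fs 0%nat z * Cconj (gs 1%nat z))%C).
{ intros w Hw.
  apply has_Dx_unique, has_Dx_mult_conj; [apply Hf | apply Hg]; exact Hw. }
assert (Hy : eq_on_disk (Dy (fun z => fs 0%nat z * Cconj (gs 0%nat z))%C)
  (fun z => Ci * fs 1%nat z * Cconj (gs 0%nat z)
            + fs 0%nat z * Cconj (Ci * gs 1%nat z))%C).
{ intros w Hw.
  apply has_Dy_unique, has_Dy_mult_conj; [apply Hf | apply Hg]; exact Hw. }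
rewrite (Dx_ext _ _ Hx z Hz), (Dy_ext _ _ Hy z Hz).
rewrite (has_Dx_unique _ _ _ (Cder_plus _ _ _ _ _
  (has_Dx_mult_conj _ _ _ _ _ (Hf 1%nat z Hz) (Hg 0%nat z Hz))
  (has_Dx_mult_conj _ _ _ _ _ (Hf 0%nat z Hz) (Hg 1%nat z Hz)))).
rewrite (has_Dy_unique _ _ _ (Cder_plus _ _ _ _ _
  (has_Dy_mult_conj _ _ _ _ _
    (jet_const_mult Ci _ Hf 1%nat z Hz) (Hg 0%nat z Hz))
  (has_Dy_mult_conj _ _ _ _ _
    (Hf 0%nat z Hz) (jet_const_mult Ci _ Hg 1%nat z Hz)))).
rewrite !Cmult_conj.
assert (E : (Ci * Ci = - (1))%C) by (apply injective_projections; simpl; ring).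
assert (E' : Cconj Ci = (- Ci)%C) by (apply injective_projections; simpl; ring).
rewrite !E'.
(* Grouped so that [Ci * Ci = -1] cancels the terms with a second derivative and gives the mixed
   term the factor 4. *)
transitivity ((1 - Ci * Ci) * (2 * (fs 1%nat z * Cconj (gs 1%nat z)))
  + (1 + Ci * Ci) * (fs 2%nat z * Cconj (gs 0%nat z)
                     + fs 0%nat z * Cconj (gs 2%nat z)))%C; [ring|].
rewrite E. ring.
Qed.

Lemma iter_laplacian_mult_conj (m : nat) (fs gs : nat -> C -> C) :
  jet fs -> jet gs ->
  eq_on_disk (Nat.iter m laplacian (fun z => fs 0%nat z * Cconj (gs 0%nat z))%C)
             (fun z => 4 ^ m * fs m z * Cconj (gs m z))%C.
Proof.
revert fs gs; induction m as [|m IH]; intros fs gs Hf Hg z Hz.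
- simpl. ring.
- rewrite Nat.iter_succ_r.
  rewrite (iter_laplacian_ext m _ _ (laplacian_mult_conj fs gs Hf Hg) z Hz).
  (* The factor 4 is absorbed into the first jet, which keeps the form of a product. *)
  rewrite (IH (fun n z => 4 * fs (S n) z)%C (fun n => gs (S n))
    (jet_const_mult 4 _ (jet_shift _ Hf)) (jet_shift _ Hg) z Hz).
  rewrite Cpow_S. ring.
Qed.

(** For a jet, this expresses that [fs 0] is a polynomial of degree below [k] on the disk. *)
Definition vanishes_from (k : nat) (fs : nat -> C -> C) : Prop :=
  forall n z, (k <= n)%nat -> fs n z = 0%C.

(** After [m] Laplacians only the product of the two [m]-th derivatives is left, and one of them is
    0. *)
Lemma polyharmonic_order_mult_conj (m : nat) (fs gs : nat -> C -> C) :
  jet fs -> jet gs -> vanishes_from m fs \/ vanishes_from m gs ->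
  polyharmonic_order m (fun z => fs 0%nat z * Cconj (gs 0%nat z))%C.
Proof.
intros Hf Hg H. split; [now apply class_C_mult_conj|].
intros z Hz. rewrite (iter_laplacian_mult_conj m fs gs Hf Hg z Hz).
destruct H as [H|H]; rewrite (H m z) by lia; [ring|].
replace (Cconj 0%C) with (RtoC 0) by (apply injective_projections; simpl; ring).
ring.
Qed.

Lemma complex_diff_id_mult (f : C -> C) (z l : C) :
  complex_diff f z l -> complex_diff (fun w => w * f w)%C z (f z + z * l)%C.
Proof.
assert (Hx0 : Cder (fun t => (t, Im z)) (Re z) 1%C)
  by (split; [exact (is_derive_id (K := R_AbsRing) (Re z))
             | exact (is_derive_const (V := R_NormedModule) (Im z) (Re z))]).
assert (Hy0 : Cder (fun t => (Re z, t)) (Im z) Ci)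
  by (split; [exact (is_derive_const (V := R_NormedModule) (Re z) (Im z))
             | exact (is_derive_id (K := R_AbsRing) (Im z))]).
intros [Hc [Hx Hy]]. split; [|split].
- apply continuous_mult_C; [apply continuous_id | exact Hc].
- unfold has_Dx. replace (f z + z * l)%C with (1 * f z + z * l)%C by ring.
  generalize (Cder_mult _ _ _ _ _ Hx0 Hx). now destruct z.
- unfold has_Dy.
  replace (Ci * (f z + z * l))%C with (Ci * f z + z * (Ci * l))%C by ring.
  generalize (Cder_mult _ _ _ _ _ Hy0 Hy). now destruct z.
Qed.

Lemma complex_diff_plus (f g : C -> C) (z l m : C) :
  complex_diff f z l -> complex_diff g z m ->
  complex_diff (fun w => f w + g w)%C z (l + m)%C.
Proof.
intros [Hfc [Hfx Hfy]] [Hgc [Hgx Hgy]]. split; [|split].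
- now apply continuous_plus_C.
- now apply Cder_plus.
- unfold has_Dy. rewrite Cmult_plus_distr_l. now apply Cder_plus.
Qed.

(* Leibniz: the n-th derivative of z f is z f^(n) + n f^(n-1); at n = 0 the
   junk index [pred 0] is annihilated by the factor n. *)
Lemma jet_id_mult (fs : nat -> C -> C) :
  jet fs -> jet (fun n z => z * fs n z + INR n * fs (pred n) z)%C.
Proof.
intros H n z Hz.
replace (z * fs (S n) z + INR (S n) * fs (pred (S n)) z)%C with
  ((fs n z + z * fs (S n) z) + INR n * fs n z)%C
  by (rewrite S_INR, RtoC_plus; simpl pred; ring).
apply complex_diff_plus.
- now apply complex_diff_id_mult, H.
- destruct n as [|n].
  + replace (INR 0 * fs 0%nat z)%C with (INR 0 * fs 1%nat z)%C by (simpl; ring).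
    apply complex_diff_const_mult, H, Hz.
  + apply complex_diff_const_mult, H, Hz.
Qed.

(** Each factor [z] raises the vanishing index by one. Applied to the constant 1, with [k = 1], this
    gives the jet of the monomial [z ^ j]. *)
Lemma jet_pow_mult (j : nat) (fs : nat -> C -> C) :
  jet fs -> exists gs, jet gs /\ (forall z, gs 0%nat z = z ^ j * fs 0%nat z)%C /\
    forall k, vanishes_from k fs -> vanishes_from (j + k) gs.
Proof.
intros H. induction j as [|j [gs [Hg [Hg0 Hv]]]].
- exists fs. split; [exact H|]. split; [intros z; simpl; ring | now intros k].
- exists (fun n z => z * gs n z + INR n * gs (pred n) z)%C.
  split; [now apply jet_id_mult|]. split.
  + intros z. rewrite Hg0. simpl. ring.
  + intros k Hk n z Hn. rewrite !(Hv k Hk) by lia. ring.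
Qed.

Lemma jet_const (c : C) : jet (fun n _ => match n with O => c | S _ => 0%C end).
Proof.
intros n z Hz. split; [apply continuous_const|].
split; [|unfold has_Dy; rewrite Cmult_0_r]; apply Cder_const.
Qed.

(** * Angular derivative *)

Lemma Cmod_pow_even (z : C) (j : nat) :
  RtoC (Cmod z ^ (2 * j)) = (z ^ j * Cconj (z ^ j))%C.
Proof. now rewrite pow_mult, RtoC_pow, Cmod2_conj, Cpow_mult_l, Cpow_conj. Qed.

(** Since [|z|^(2j) = z^j conj(z^j)], the function is [c z^j f conj(z^j) + c z^j conj(z^j g)]. In
    each product one factor is a multiple of [z^j], whose derivatives vanish from order [j + 1 <= m]
    on. *)
Lemma polyharmonic_order_pow_mult (m j : nat) (c : C) (f g : C -> C) :
  analytic f -> analytic g -> (j < m)%nat ->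
  polyharmonic_order m
    (fun z => c * RtoC (Cmod z ^ (2 * j)) * (f z + Cconj (g z)))%C.
Proof.
intros Hf Hg Hj.
destruct (analytic_jet f Hf) as [fs [Jf <-]].
destruct (analytic_jet g Hg) as [gs [Jg <-]].
destruct (jet_pow_mult j fs Jf) as [fs' [Jf' [Ef _]]].
destruct (jet_pow_mult j gs Jg) as [gs' [Jg' [Eg _]]].
destruct (jet_pow_mult j _ (jet_const 1%C)) as [qs [Jq [Eq Vq]]].
assert (Vm : vanishes_from m qs).
{ intros n z Hn. apply (Vq 1%nat); [|lia].
  intros [|k] w Hk; [lia | reflexivity]. }
apply polyharmonic_order_ext with
  (fun z => (c * fs' 0%nat z) * Cconj (qs 0%nat z)
            + (c * qs 0%nat z) * Cconj (gs' 0%nat z))%C.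
{ intros z _. rewrite Ef, Eg, Eq, Cmod_pow_even, Cmult_1_r, !Cmult_conj. ring. }
apply polyharmonic_order_plus.
- apply (polyharmonic_order_mult_conj m (fun n z => c * fs' n z)%C qs);
    auto using jet_const_mult.
- apply (polyharmonic_order_mult_conj m (fun n z => c * qs n z)%C gs');
    auto using jet_const_mult.
  left. intros n z Hn. rewrite (Vm n z Hn). ring.
Qed.

(** * Polyharmonicity of the exponent sum times a harmonic function *)

Lemma exponent_sum_S (p : nat) (lam : nat -> C) (z : C) :
  exponent_sum (S p) lam z = (exponent_sum p lam z + exponent lam (S p) z)%C.
Proof. unfold exponent_sum. rewrite sum_n_Sm by lia. reflexivity. Qed.

Lemma exponent_sum_0 (lam : nat -> C) (z : C) : exponent_sum 0 lam z = 0%C.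
Proof. unfold exponent_sum. rewrite sum_n_m_zero by lia. reflexivity. Qed.

(** The order [p] stays fixed while the number [q] of summands grows, so that all summands have the
    same order. *)
Lemma polyharmonic_order_exponent_sum (p q : nat) (lam : nat -> C) (f g : C -> C) :
  analytic f -> analytic g -> (q <= p)%nat -> (1 <= p)%nat ->
  polyharmonic_order p
    (fun z => exponent_sum q lam z * (f z + Cconj (g z)))%C.
Proof.
intros Hf Hg Hq Hp. induction q as [|q IH].
(* The empty sum is presented as the term [j = 0] with coefficient 0, which requires [0 < p]. *)
- eapply polyharmonic_order_ext;
    [|apply (polyharmonic_order_pow_mult p 0 0%C f g Hf Hg); lia].
  intros z _. cbv beta. rewrite exponent_sum_0. ring.
- eapply polyharmonic_order_ext;
    [|apply polyharmonic_order_plus;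
      [apply IH; lia
      |apply (polyharmonic_order_pow_mult p q (lam (S q)) f g Hf Hg); lia]].
  intros z _. cbv beta. rewrite exponent_sum_S. unfold exponent.
  replace (S q - 1)%nat with q by lia. ring.
Qed.

(** * Differentiation along circles and radial factors *)

Definition angular (f : C -> C) (z : C) : C :=
  (z * d_z f z - Cconj z * d_zbar f z)%C.

Lemma angular_Dx_Dy (f : C -> C) (z : C) :
  angular f z = (Ci * (Im z * Dx f z - Re z * Dy f z))%C.
Proof.
unfold angular, d_z, d_zbar.
generalize (Dx f z) (Dy f z); intros u v.
destruct z as [x y], u as [u1 u2], v as [v1 v2].
apply injective_projections; simpl; field.
Qed.

(** The gradient of [s] is a complex multiple of the position vector, so [y s_x - x s_y = 0]. No
    division by [Cmod z] occurs, so the origin is no exception. *)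
Definition radial_at (s : C -> C) (z : C) : Prop :=
  exists d, has_Dx s z (Re z * d)%C /\ has_Dy s z (Im z * d)%C.

(** In the product rule the terms that differentiate [s] cancel. *)
Lemma angular_radial_mult (s f g : C -> C) (z : C) :
  disk z -> radial_at s z -> ex_Dx f z -> ex_Dy f z ->
  eq_on_disk g (fun w => s w * f w)%C ->
  angular g z = (s z * angular f z)%C.
Proof.
intros Hz [d [Hx Hy]] Hfx Hfy E. rewrite !angular_Dx_Dy.
rewrite (Dx_ext _ _ E z Hz), (Dy_ext _ _ E z Hz).
rewrite (has_Dx_unique _ _ _ (Cder_mult _ _ _ _ _ Hx (ex_Dx_has _ _ Hfx))).
rewrite (has_Dy_unique _ _ _ (Cder_mult _ _ _ _ _ Hy (ex_Dy_has _ _ Hfy))).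
replace (Re z, Im z) with z by now destruct z.
ring.
Qed.

Lemma is_derive_norm_pow (j : nat) (y t : R) :
  is_derive (fun s : R => (s ^ 2 + y ^ 2) ^ j) t
    (t * (2 * INR j * (t ^ 2 + y ^ 2) ^ pred j)).
Proof. auto_derive; [trivial|]. simpl. ring. Qed.

Lemma Cmod_pow_even_real (x y : R) (j : nat) :
  Cmod (x, y) ^ (2 * j) = (x ^ 2 + y ^ 2) ^ j.
Proof. now rewrite pow_mult, Cmod2_alt. Qed.

Lemma radial_exponent (lam : nat -> C) (k : nat) (z : C) :
  radial_at (exponent lam k) z.
Proof.
set (j := (k - 1)%nat).
(* The common factor of both partial derivatives of [lam k * (x^2 + y^2)^j]; at [j = 0] the
   truncated [pred j] is harmless because of [INR j]. *)
exists (lam k * RtoC (2 * INR j * (Re z ^ 2 + Im z ^ 2) ^ pred j))%C.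
unfold has_Dx, has_Dy, exponent. fold j. split.
- set (D := (2 * INR j * (Re z ^ 2 + Im z ^ 2) ^ pred j)).
  replace (Re z * (lam k * D))%C with (0 * RtoC (Cmod (Re z, Im z) ^ (2 * j))
    + lam k * RtoC (Re z * D))%C by (rewrite RtoC_mult; ring).
  apply (Cder_mult (fun _ => lam k) (fun t => RtoC (Cmod (t, Im z) ^ (2 * j))));
    [apply Cder_const|]. split.
  + apply (is_derive_ext (fun s : R => (s ^ 2 + Im z ^ 2) ^ j)).
    * intros s. exact (eq_sym (Cmod_pow_even_real s (Im z) j)).
    * apply is_derive_norm_pow.
  + exact (is_derive_const (V := R_NormedModule) 0 (Re z)).
- rewrite (Rplus_comm (Re z ^ 2)).
  set (D := (2 * INR j * (Im z ^ 2 + Re z ^ 2) ^ pred j)).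
  replace (Im z * (lam k * D))%C with (0 * RtoC (Cmod (Re z, Im z) ^ (2 * j))
    + lam k * RtoC (Im z * D))%C by (rewrite RtoC_mult; ring).
  apply (Cder_mult (fun _ => lam k) (fun t => RtoC (Cmod (Re z, t) ^ (2 * j))));
    [apply Cder_const|]. split.
  + apply (is_derive_ext (fun s : R => (s ^ 2 + Re z ^ 2) ^ j)).
    * intros s. rewrite Rplus_comm. exact (eq_sym (Cmod_pow_even_real (Re z) s j)).
    * apply is_derive_norm_pow.
  + exact (is_derive_const (V := R_NormedModule) 0 (Im z)).
Qed.

Lemma Cder_ext (phi psi : R -> C) (t : R) (l : C) :
  (forall s, phi s = psi s) -> Cder phi t l -> Cder psi t l.
Proof. intros E. apply Cder_ext_loc, filter_forall, E. Qed.

Lemma radial_exponent_sum (p : nat) (lam : nat -> C) (z : C) :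
  radial_at (exponent_sum p lam) z.
Proof.
induction p as [|p [d [Hx Hy]]].
- exists 0%C. unfold has_Dx, has_Dy. rewrite !Cmult_0_r.
  split; (eapply Cder_ext; [|apply (Cder_const 0%C)]); intros s;
    symmetry; apply exponent_sum_0.
- destruct (radial_exponent lam (S p) z) as [e [Hx' Hy']].
  exists (d + e)%C. unfold has_Dx, has_Dy. rewrite !Cmult_plus_distr_l.
  split; (eapply Cder_ext; [|eapply Cder_plus; eassumption]); intros s;
    symmetry; apply exponent_sum_S.
Qed.

(** * Chain rule along curves and the argument on a small circle *)

Lemma is_derive_curve (f fx : R -> R -> R) (fy : R) (a b : R -> R) (t a' b' : R) :
  locally (a t, b t) (fun u : R * R =>
    is_derive (fun s : R => f s (snd u)) (fst u) (fx (fst u) (snd u))) ->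
  is_derive (fun s : R => f (a t) s) (b t) fy ->
  continuous (fun u : R * R => fx (fst u) (snd u)) (a t, b t) ->
  is_derive a t a' -> is_derive b t b' ->
  is_derive (fun s : R => f (a s) (b s)) t (a' * fx (a t) (b t) + b' * fy).
Proof.
intros H1 H2 H3 Ha Hb.
assert (H := filterdiff_comp'_2 a b f t _ _
  (fun x y : R => plus (scal x (fx (a t) (b t))) (scal y fy)) Ha Hb
  (is_derive_filterdiff f (a t) (b t) fx fy H1 H2 H3)).
eapply filterdiff_ext_lin; [exact H|]. intros y.
unfold scal, plus; simpl. unfold mult; simpl. ring.
Qed.

Lemma Cder_curve (h : C -> C) (a b : R -> R) (t a' b' : R) :
  class_C 1 h -> disk (a t, b t) -> is_derive a t a' -> is_derive b t b' ->
  Cder (fun s => h (a s, b s)) t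
    (a' * Dx h (a t, b t) + b' * Dy h (a t, b t))%C.
Proof.
intros [_ [Hd [[Hx _] _]]] Hz Ha Hb.
specialize (Hx _ Hz). split.
- replace (Re (a' * Dx h (a t, b t) + b' * Dy h (a t, b t))%C)
    with (a' * Re (Dx h (a t, b t)) + b' * Re (Dy h (a t, b t)))
    by (unfold Re; simpl; ring).
  apply (is_derive_curve (fun x y => Re (h (x, y))) (fun x y => Re (Dx h (x, y)))).
  + generalize (disk_locally _ Hz). apply filter_imp. intros [x y] Hu.
    exact (proj1 (ex_Dx_has h _ (proj1 (Hd _ Hu)))).
  + exact (proj1 (ex_Dy_has h _ (proj2 (Hd _ Hz)))).
  + apply (continuous_ext (fun u : R * R => fst (Dx h u))); [now intros [x y]|].
    apply (continuous_comp (V := C_UniformSpace) (Dx h) fst); [exact Hx|].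
    destruct (Dx h (a t, b t)). apply continuous_fst.
  + exact Ha.
  + exact Hb.
- replace (Im (a' * Dx h (a t, b t) + b' * Dy h (a t, b t))%C)
    with (a' * Im (Dx h (a t, b t)) + b' * Im (Dy h (a t, b t)))
    by (unfold Im; simpl; ring).
  apply (is_derive_curve (fun x y => Im (h (x, y))) (fun x y => Im (Dx h (x, y)))).
  + generalize (disk_locally _ Hz). apply filter_imp. intros [x y] Hu.
    exact (proj2 (ex_Dx_has h _ (proj1 (Hd _ Hu)))).
  + exact (proj2 (ex_Dy_has h _ (proj2 (Hd _ Hz)))).
  + apply (continuous_ext (fun u : R * R => snd (Dx h u))); [now intros [x y]|].
    apply (continuous_comp (V := C_UniformSpace) (Dx h) snd); [exact Hx|].
    destruct (Dx h (a t, b t)). apply continuous_snd.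
  + exact Ha.
  + exact Hb.
Qed.

(* On a small circle h stays in the half-plane around h 0, so its argument is
   a periodic function of the angle and has a critical point. *)
Lemma angular_critical_point (h : C -> C) :
  class_C 1 h -> h 0%C <> 0%C ->
  exists z, disk z /\ z <> 0%C /\ Re (angular h z / h z)%C = 0.
Proof.
intros Hh H0.
assert (Hc0 := proj1 (Cmod_gt_0 _) H0).
assert (D0 : disk 0%C) by (unfold disk; rewrite Cmod_0; lra).
destruct (proj1 (continuous_Cmod h 0%C) (proj1 Hh _ D0) _ Hc0) as [d [Hd Hclose]].
(* The circle of radius [r] lies in the disk and where [h] differs from [h 0] by less than
   [Cmod (h 0)]. *)
set (r := Rmin d 1 / 2).
assert (Hr : 0 < r < d /\ r < 1).
{ assert (H1 := Rmin_l d 1). assert (H2 := Rmin_r d 1).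
  assert (H3 : 0 < Rmin d 1) by (apply Rmin_pos; lra). unfold r. lra. }
set (a := fun t : R => r * cos t). set (b := fun t : R => r * sin t).
assert (Hmod : forall t, Cmod (a t, b t) = r).
{ intros t. unfold Cmod, a, b; simpl.
  replace (r * cos t * (r * cos t * 1) + r * sin t * (r * sin t * 1))
    with (r² * ((sin t)² + (cos t)²)) by (unfold Rsqr; ring).
  rewrite sin2_cos2, Rmult_1_r. apply sqrt_Rsqr. lra. }
assert (Hdisk : forall t, disk (a t, b t)) by (intros t; unfold disk; rewrite Hmod; lra).
assert (Ha : forall t : R, is_derive a t (- b t))
  by (intros t; unfold a, b; auto_derive; [trivial | ring]).
assert (Hb : forall t : R, is_derive b t (a t))
  by (intros t; unfold a, b; auto_derive; [trivial | ring]).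
set (c := h 0%C) in *.
(* Multiplication by [Cconj c] turns the half-plane around [c = h 0] into the right half-plane. *)
set (u := fun t => (h (a t, b t) * Cconj c)%C).
(* The derivative of [h] along the circle is [-y h_x + x h_y], which is [Ci * angular h]. *)
set (u' := fun t => (Ci * angular h (a t, b t) * Cconj c)%C).
assert (Hu : forall t, Cder u t (u' t)).
{ intros t. unfold u, u'.
  replace (Ci * angular h (a t, b t) * Cconj c)%C with
    ((RtoC (- b t) * Dx h (a t, b t) + RtoC (a t) * Dy h (a t, b t)) * Cconj c
      + h (a t, b t) * 0)%C.
  - apply (Cder_mult (fun s => h (a s, b s)) (fun _ => Cconj c));
      [now apply Cder_curve | apply Cder_const].
  - rewrite angular_Dx_Dy. simpl Re; simpl Im.
    apply injective_projections; simpl; ring. }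
assert (Hpos : forall t, 0 < Re (u t)).
{ intros t. unfold u.
  replace (h (a t, b t) * Cconj c)%C
    with (c * Cconj c + (h (a t, b t) - c) * Cconj c)%C by ring.
  rewrite <- Cmod2_conj, re_plus, re_RtoC.
  assert (Hlt : Cmod (h (a t, b t) - c)%C < Cmod c).
  { apply Hclose. replace ((a t, b t) - 0)%C with (a t, b t)
      by (apply injective_projections; simpl; ring).
    rewrite Hmod. lra. }
  assert (Hre := re_le_Cmod ((h (a t, b t) - c) * Cconj c)%C).
  rewrite Cmod_mult, Cmod_conj in Hre.
  apply Rabs_le_between in Hre.
  assert (Cmod (h (a t, b t) - c)%C * Cmod c < Cmod c * Cmod c)
    by (apply Rmult_lt_compat_r; assumption).
  replace (Cmod c ^ 2) with (Cmod c * Cmod c) by ring. lra. }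
(* The tangent of the argument of [u]: it has the same critical points and needs no branch of the
   argument. *)
set (q := fun t : R => Im (u t) / Re (u t)).
assert (Hq : forall t : R, is_derive q t
  ((Im (u' t) * Re (u t) - Im (u t) * Re (u' t)) / Re (u t) ^ 2)).
{ intros t. unfold q. destruct (Hu t) as [H1 H2].
  assert (Hp := Hpos t).
  evar_last; [apply is_derive_div; [exact H2 | exact H1 | lra] | reflexivity]. }
(* The mean value theorem over a full period yields a zero of the derivative of [q]. *)
destruct (MVT_gen q 0 (2 * PI)
  (fun t => (Im (u' t) * Re (u t) - Im (u t) * Re (u' t)) / Re (u t) ^ 2))
  as [t [_ Ht]].
{ intros t _. apply Hq. }
{ intros t _. apply continuity_pt_filterlim.
  apply (ex_derive_continuous q). eexists. apply Hq. }
assert (Hper : q (2 * PI) = q 0)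
  by (unfold q, u, a, b; now rewrite cos_2PI, sin_2PI, cos_0, sin_0).
rewrite Hper, Rminus_diag, Rminus_0_r in Ht.
exists (a t, b t). split; [apply Hdisk|]. split.
{ intros E. generalize (Hmod t). rewrite E, Cmod_0. lra. }
assert (Hp := Hpos t). assert (HPI := PI_RGT_0).
assert (Hz : Im (u' t) * Re (u t) - Im (u t) * Re (u' t) = 0).
{ symmetry in Ht. apply Rmult_integral in Ht. destruct Ht as [Ht|Ht]; [|lra].
  unfold Rdiv in Ht. apply Rmult_integral in Ht. destruct Ht as [Ht|Ht]; [exact Ht|].
  exfalso. revert Ht. apply Rinv_neq_0_compat, pow_nonzero. lra. }
revert Hz Hp. unfold u, u'.
generalize (angular h (a t, b t)) (h (a t, b t)).
clearbody c. clear - Hc0 H0. intros L w. destruct L as [L1 L2], w as [w1 w2], c as [c1 c2].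
unfold Re, Im. simpl. intros Hz Hp.
assert (Hc : 0 < c1 * c1 + c2 * c2).
{ unfold Cmod in Hc0. simpl in Hc0. apply Rnot_le_lt. intros N.
  rewrite sqrt_neg_0 in Hc0; lra. }
assert (Hw : w1 ^ 2 + w2 ^ 2 <> 0).
{ intros E. assert (w1 = 0) by nra. assert (w2 = 0) by nra. subst. lra. }
(* The numerator of the derivative of [q] is [Im (u' conj u) = |c|^2 Re (L conj w)], and
   [Re (L / w)] is [Re (L conj w) / |w|^2]. *)
assert (K : (c1 * c1 + c2 * c2) * (L1 * w1 + L2 * w2) = 0) by (rewrite <- Hz; ring).
apply Rmult_integral in K. destruct K as [K|K]; [lra|].
replace (L1 * (w1 / (w1 * (w1 * 1) + w2 * (w2 * 1))) -
  L2 * (- w2 / (w1 * (w1 * 1) + w2 * (w2 * 1))))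
  with ((L1 * w1 + L2 * w2) / (w1 ^ 2 + w2 ^ 2)) by (field; simpl in Hw; lra).
rewrite K. unfold Rdiv. ring.
Qed.

(** * Equality of the two starlikeness quotients and the value at the origin *)

Theorem theorem2 :
  forall (p : nat) (G logG : C -> C) (lam : nat -> C) (F logF : C -> C),
    (1 <= p)%nat ->
    nonvanishing_log_harmonic G ->
    log_of_log_harmonic G logG ->
    (forall z : C, disk z -> F z = power_product p lam logG z) ->
    (forall z : C, disk z -> logF z = (exponent_sum p lam z * logG z)%C) ->
    univalent logF ->
    univalent logG ->
    (forall z : C, disk z -> z <> 0%C -> exponent_sum p lam z <> 0%C) ->
    (starlike logG <-> starlike logF).
Proof.
intros p G logG lam F logF Hp _ HG _ HF UF UG HS.
destruct HG as [g1 [g2 [l1 [l2 [_ [[A1 _] [[A2 _] HlG]]]]]]].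
(* [logG] is the case [j = 0] with coefficient 1, hence harmonic. *)
assert (PG : polyharmonic_order 1 logG).
{ eapply polyharmonic_order_ext;
    [|apply (polyharmonic_order_pow_mult 1 0 1%C l1 l2 A1 A2); lia].
  intros z Hz. rewrite (HlG z Hz). simpl. ring. }
assert (PF : polyharmonic_order p logF).
{ eapply polyharmonic_order_ext;
    [|apply (polyharmonic_order_exponent_sum p p lam l1 l2 A1 A2); lia].
  intros z Hz. now rewrite (HF z Hz), (HlG z Hz). }
assert (C1 : class_C 1 logG) by (apply (class_C_le 1 2); [lia | apply PG]).
assert (Hratio : forall z, disk z -> z <> 0%C ->
  (angular logF z / logF z = angular logG z / logG z)%C).
{ intros z Hz Hz0. destruct C1 as [_ [Hd _]]. destruct (Hd z Hz) as [Hx Hy].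
  rewrite (angular_radial_mult (exponent_sum p lam) logG logF z Hz
    (radial_exponent_sum p lam z) Hx Hy HF), (HF z Hz).
  specialize (HS z Hz Hz0).
  destruct (Ceq_dec (logG z) 0) as [E|E].
  (* At a zero of [logG] both denominators are 0; the complex inverse of 0 evaluates to 0, so both
     quotients are 0. *)
  - assert (E0 : (/ 0)%C = RtoC 0)
      by (apply injective_projections; simpl; unfold Rdiv; ring).
    rewrite E, Cmult_0_r. unfold Cdiv. rewrite E0. ring.
  - field. now split. }
assert (D0 : disk 0%C) by (unfold disk; rewrite Cmod_0; lra).
split; intros [_ [_ [H0 Hpos]]]; (split; [assumption|]).
- split; [exists p; split; [exact Hp | exact PF]|]. split.
  + rewrite (HF _ D0), H0. ring.
  (* [angular] is the numerator in [starlike], so the condition there is convertible to this one. *)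
  + intros z Hz Hz0. change (0 < Re (angular logF z / logF z)%C).
    rewrite Hratio by assumption. now apply Hpos.
- split; [exists 1%nat; split; [lia | exact PG]|]. split.
  (* The exponent sum may vanish at 0, so [logF 0 = 0] does not settle the value of [logG]; a
     nonzero value contradicts positivity at the critical point. *)
  + destruct (Ceq_dec (logG 0%C) 0) as [E|E]; [exact E|].
    destruct (angular_critical_point logG C1 E) as [z [Hz [Hz0 Hcrit]]].
    specialize (Hpos z Hz Hz0).
    change (0 < Re (angular logF z / logF z)%C) in Hpos.
    rewrite Hratio in Hpos by assumption. lra.
  + intros z Hz Hz0. change (0 < Re (angular logG z / logG z)%C).
    rewrite <- Hratio by assumption. now apply Hpos.
Qed.
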